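(* Let $\mathbb{K}$ be a field, let $k\geq 3$, and let $X\subset\mathbb{P}^{k-1}$ be a finite set of $n$ distinct $\mathbb{K}$-rational points, not all contained in a hyperplane. Let $a\geq 1$ be an integer. Then $$d(X)_a\geq (k-1)(\alpha(X)-1-a)+1.$$
   Context: $R=\mathbb{K}[x_1,\ldots,x_k]$ is the polynomial ring with the standard grading and $R_a$ is the $\mathbb{K}$-vector space of homogeneous polynomials of degree $a$. For a finite set of $\mathbb{K}$-rational points $X=\{P_1,\ldots,P_n\}\subset\mathbb{P}^{k-1}$, $I(X)\subset R$ is its (homogeneous) defining ideal, i.e. the ideal generated by all forms vanishing at every point of $X$. The initial degree $\alpha(X)$ is the smallest degree of a nonzero element of $I(X)$. The right-hand side of the inequality is an integer that may be negative. Fix for each $P_i$ the representative in $\mathbb{K}^k$ whose leftmost nonzero coordinate is $1$. The evaluation code of order $a$ associated to $X$ is the image $\mathcal{C}(X)_a\subset\mathbb{K}^n$ of the linear map $R_a\to\mathbb{K}^n$, $f\mapsto (f(P_1),\ldots,f(P_n))$. Its minimum (Hamming) distance is denoted $d(X)_a$. Equivalently, $d(X)_a$ is the minimum, over all $f\in R_a\setminus I(X)$, of the number of points of $X$ at which $f$ does not vanish. *)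

(* Defs.v *)
From Stdlib Require Import Classical ClassicalEpsilon.
From mathcomp Require Import all_boot all_order all_algebra.
From mathcomp Require Export mpoly.

Set Implicit Arguments.
Unset Strict Implicit.
Unset Printing Implicit Defensive.

Import Order.TTheory GRing.Theory Num.Theory.
Local Open Scope ring_scope.

(* The minimum of a set of natural numbers; meaningful only when the set is
   nonempty, see [leastP]. *)
Definition least (S : nat -> Prop) : nat :=
  epsilon (inhabits 0%N) (fun m => S m /\ forall j, S j -> (m <= j)%N).

Lemma leastP (S : nat -> Prop) :
  (exists m, S m) -> S (least S) /\ forall j, S j -> (least S <= j)%N.
Proof.
move=> [m Sm].
apply: (epsilon_spec (inhabits 0%N) (fun m => S m /\ forall j, S j -> (m <= j)%N)).
elim/ltn_ind: m Sm => m IH Sm.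
case: (classic (exists2 j, (j < m)%N & S j)) => [[j ltjm Sj]|noS].
  exact: IH ltjm Sj.
exists m; split=> // j Sj; rewrite leqNgt; apply/negP => ltjm.
by apply: noS; exists j.
Qed.

Definition leading_one (K : fieldType) (k : nat) (v : 'rV[K]_k) : bool :=
  [exists i : 'I_k, (v 0 i == 1) && [forall j : 'I_k, (j < i)%N ==> (v 0 j == 0)]].

(* The K-rational points of the (k-1)-dimensional projective space, each
   identified with its unique representative whose leftmost nonzero coordinate
   is 1 (see [proj_point_rep]); hence distinct elements are distinct points. *)
Definition proj_point (K : fieldType) (k : nat) : Type :=
  {v : 'rV[K]_k | leading_one v}.

Lemma proj_point_rep (K : fieldType) (k : nat) (v : 'rV[K]_k) :
  v != 0 -> exists! P : proj_point K k, exists2 c : K, c != 0 & val P = c *: v.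
Proof.
move=> v0.
have [i0 vi0] : exists i, v 0 i != 0.
  apply/existsP; apply: contraR v0 => /existsPn v0.
  by apply/eqP/rowP => j; rewrite mxE; apply/eqP/negbNE/v0.
case: (arg_minnP (fun i : 'I_k => val i) (vi0 : (fun i => v 0 i != 0) i0)) => i vi imin.
have vlt (j : 'I_k) : (j < i)%N -> v 0 j = 0.
  by move=> ji; apply/eqP; apply: contraTT ji => /imin; rewrite -leqNgt.
have lo : leading_one ((v 0 i)^-1 *: v).
  apply/existsP; exists i; rewrite mxE mulVf // eqxx /=.
  by apply/forallP => j; apply/implyP => ji; rewrite mxE (vlt j ji) mulr0.
exists (exist (fun w : 'rV[K]_k => leading_one w) _ lo).
split; first by exists (v 0 i)^-1; rewrite ?invr_eq0.
move=> [w low] [c c0 /= ew]; apply: val_inj => /=; rewrite ew.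
case/existsP: low => i' /andP[/eqP wi' /forallP wlt]; move: wi' wlt.
rewrite ew mxE => cvi wlt.
have vi' : v 0 i' != 0.
  by apply: contraTneq (oner_neq0 K) => vi'0; rewrite -cvi vi'0 mulr0 eqxx.
suff -> : i = i' by rewrite -[c](mulfK vi') cvi mul1r.
apply: val_inj; apply/eqP; rewrite eqn_leq; apply/andP; split; first exact: imin.
rewrite leqNgt; apply/negP => ii'; move: (wlt i); rewrite ii' mxE /=.
by rewrite mulf_eq0 (negbTE c0) (negbTE vi).
Qed.

Section Points.
Variables (K : fieldType) (k n : nat).

Definition eval_at (f : {mpoly K[k]}) (P : proj_point K k) : K :=
  f.@[fun j => val P 0 j].

Variable X : 'I_n -> proj_point K k.

Definition in_hyperplane : Prop :=
  exists l : {mpoly K[k]},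
    [/\ l \is 1%N.-homog, l != 0 & forall i, eval_at l (X i) = 0].

Definition vanishing_form (f : {mpoly K[k]}) : Prop :=
  (exists e : nat, f \is e.-homog) /\ forall i, eval_at f (X i) = 0.

Definition defining_ideal (p : {mpoly K[k]}) : Prop :=
  exists (m : nat) (g f : 'I_m -> {mpoly K[k]}),
    (forall j, vanishing_form (f j)) /\ p = \sum_(j < m) g j * f j.

(* [msize f] is 1 + the total degree of [f] when [f != 0]. *)
Definition initial_degree : nat :=
  least (fun e => exists f : {mpoly K[k]},
    [/\ defining_ideal f, f != 0 & (msize f).-1 = e]).

Definition evaluation_word (f : {mpoly K[k]}) : 'rV[K]_n :=
  \row_i eval_at f (X i).

Definition evaluation_code (d : nat) (w : 'rV[K]_n) : Prop :=
  exists2 f : {mpoly K[k]}, f \is d.-homog & w = evaluation_word f.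

End Points.

Definition hamming_distance (K : fieldType) (n : nat) (u w : 'rV[K]_n) : nat :=
  #|[set i | u 0 i != w 0 i]|.

Definition minimum_distance (K : fieldType) (n : nat) (C : 'rV[K]_n -> Prop) : nat :=
  least (fun d => exists u w : 'rV[K]_n,
    [/\ C u, C w, u <> w & hamming_distance u w = d]).

(* The two minima above range over nonempty sets. *)

Lemma defining_ideal_nonzero (K : fieldType) (k n : nat)
    (X : 'I_n -> proj_point K k) :
  (1 < k)%N -> exists2 f : {mpoly K[k]}, defining_ideal X f & f != 0.
Proof.
move=> k1.
have lin (P : proj_point K k) : exists l : {mpoly K[k]},
    [/\ l \is 1%N.-homog, l != 0 & eval_at l P = 0].
  case: P => v lo; have := lo; case/existsP => i /andP[/eqP vi _].
  have [j ji] : exists j : 'I_k, j != i.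
    apply/existsP; apply: contraLR k1 => /existsPn h; rewrite -leqNgt.
    rewrite -[k]card_ord -(card1 i); apply/subset_leq_card/subsetP => j _.
    by rewrite inE; apply/negbNE/h.
  exists ('X_j - v 0 j *: 'X_i); split.
  - by rewrite rpredB ?rpredZ ?dhomogX /= ?mdeg1.
  - apply/negP => /eqP /(congr1 (fun p : {mpoly K[k]} => p@_U_(j))) /eqP.
    rewrite mcoeffB mcoeffZ !mcoeffXU eqxx mcoeff0.
    by rewrite [i == j]eq_sym (negbTE ji) mulr0 subr0 oner_eq0.
  - by rewrite /eval_at mevalB mevalZ !mevalXU /= vi mulr1 subrr.
suff [f [fn f0 fX]] : exists f : {mpoly K[k]},
    [/\ exists e : nat, f \is e.-homog, f != 0 & forall i, eval_at f (X i) = 0].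
  exists f => //; exists 1%N, (fun=> 1), (fun=> f); split=> //.
  by rewrite big_ord1 mul1r.
suff [f [fn f0 fX]] : exists f : {mpoly K[k]},
    [/\ exists e : nat, f \is e.-homog, f != 0
      & forall i, i \in enum 'I_n -> eval_at f (X i) = 0].
  by exists f; split=> // i; apply: fX; rewrite mem_enum.
elim: (enum 'I_n) => [|i s [f [[e fe] f0 fX]]].
  by exists 1; split; rewrite ?oner_neq0 //; exists 0%N; exact: dhomog1.
have [l [l1 l0 lX]] := lin (X i).
exists (l * f); split; first by exists (1 + e)%N; exact: dhomogM.
  by rewrite mulf_neq0.
move=> j; rewrite inE /eval_at mevalM => /orP[/eqP ->|/fX].
  by rewrite -/(eval_at l _) lX mul0r.
by rewrite /eval_at => ->; rewrite mulr0.
Qed.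

Lemma evaluation_code_nontrivial (K : fieldType) (k n : nat)
    (X : 'I_n -> proj_point K k) (a : nat) :
  (0 < n)%N -> exists u w : 'rV[K]_n,
    [/\ evaluation_code X a u, evaluation_code X a w & u <> w].
Proof.
case: n X => // n X _.
case EP: (X ord0) => [v lo]; have := lo; case/existsP => i /andP[/eqP vi _].
exists (evaluation_word X ('X_i ^+ a)), (evaluation_word X 0); split.
- exists ('X_i ^+ a) => //; rewrite -[X in X.-homog]mul1n.
  by apply: dhomogMn; rewrite dhomogX /= mdeg1.
- by exists 0; rewrite ?rpred0.
move=> /rowP/(_ ord0)/eqP.
by rewrite !mxE /eval_at EP meval0 rmorphXn /= mevalXU vi expr1n oner_eq0.
Qed.

(* Main.v *)
Require Import Defs.
From mathcomp Require Import all_boot all_order all_algebra.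
From mathcomp Require Import zify.

(** Let [f] be a form of degree [a] whose nonvanishing set [Y] in [X] has
    [d = d(X)_a] points. Any [k - 1] points of projective [(k-1)]-space lie on a
    hyperplane, so splitting [Y] into groups of [k - 1] points yields a product
    [g] of [ceil(d / (k - 1))] linear forms vanishing on [Y]. Then [f * g] is a
    nonzero form vanishing on [X], whence [alpha(X) <= a + ceil(d / (k - 1))]. *)

Import Order.TTheory GRing.Theory Num.Theory.
Local Open Scope ring_scope.

(** The coordinates of the points form a matrix with [k] rows and fewer than [k] columns, so it has
    a nonzero left kernel vector, whose entries serve as the coefficients of [l]. *)
Lemma linear_form_through (K : fieldType) (k : nat) (s : seq (proj_point K k)) :
  (size s < k)%N -> exists l : {mpoly K[k]},
    [/\ l \is 1%N.-homog, l != 0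
      & forall i : 'I_(size s), eval_at l (tnth (in_tuple s) i) = 0].
Proof.
move=> sk; set M := \matrix_(j < k, i < size s) val (tnth (in_tuple s) i) 0 j.
have ker0 : kermx M != 0.
  by rewrite -mxrank_eq0 mxrank_ker subn_eq0 -ltnNge (leq_ltn_trans (rank_leq_col M)).
set c := nz_row (kermx M).
have c0 : c != 0 by rewrite nz_row_eq0.
have cM : c *m M = 0 by apply/sub_kermxP/nz_row_sub.
exists (\sum_(j < k) c 0 j *: 'X_j); split.
- by rewrite rpred_sum // => j _; rewrite rpredZ // dhomogX /= mdeg1.
- apply: contra_neq c0 => /mpolyP l0; apply/rowP => j.
  have := l0 U_(j)%MM; rewrite mcoeff0 raddf_sum /= mxE => <-.
  rewrite (bigD1 j) //= mcoeffZ mcoeffXU eqxx mulr1 big1 ?addr0 // => i ij.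
  by rewrite mcoeffZ mcoeffXU (negbTE ij) mulr0.
- move=> i; have /rowP/(_ i) := cM; rewrite !mxE => cMi.
  rewrite /eval_at raddf_sum /= -[RHS]cMi; apply: eq_bigr => j _.
  by rewrite mevalZ mevalXU mxE.
Qed.

(** Each induction step peels off up to [k.-1] points. Groups may be short or even empty, so the
    degree is exactly [m] however few points there are. *)
Lemma form_through (K : fieldType) (k m n : nat) (X : 'I_n -> proj_point K k)
    (s : seq 'I_n) :
  (0 < k)%N -> (size s <= m * k.-1)%N -> exists g : {mpoly K[k]},
    [/\ g \is m.-homog, g != 0 & forall i, i \in s -> eval_at g (X i) = 0].
Proof.
move=> k0; elim: m s => [|m IH] s sm.
  exists 1; split; rewrite ?oner_neq0 ?dhomog1 //.
  by move: sm; rewrite mul0n leqn0 size_eq0 => /eqP->.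
have [|g [gm g0 gs]] := IH (drop k.-1 s); first by rewrite size_drop; nia.
set t := map X (take k.-1 s).
have [|l [l1 l0 lt]] := @linear_form_through K k t.
  by rewrite size_map size_take_min; lia.
exists (l * g); split; first exact: (dhomogM l1 gm).
  by rewrite mulf_neq0.
move=> i; rewrite -{1}(cat_take_drop k.-1 s) mem_cat /eval_at mevalM.
case/orP => [it|/gs]; last by rewrite /eval_at => ->; rewrite mulr0.
have Xt : (index i (take k.-1 s) < size t)%N by rewrite size_map index_mem.
have := lt (Ordinal Xt).
rewrite (tnth_nth (X i)) /= (nth_map i) ?index_mem // nth_index // /eval_at => ->.
by rewrite mul0r.
Qed.

Lemma initial_degree_le (K : fieldType) (k n e : nat) (X : 'I_n -> proj_point K k)
    (f : {mpoly K[k]}) :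
  f \is e.-homog -> f != 0 -> (forall i, eval_at f (X i) = 0) ->
  (initial_degree X <= e)%N.
Proof.
move=> fe f0 fX.
pose S d := exists p : {mpoly K[k]}, [/\ defining_ideal X p, p != 0 & (msize p).-1 = d].
have Se : S e.
  (* A nonzero form is homogeneous of only one degree, so [(msize f).-1] is [e]. *)
  exists f; split=> //; last exact: dhomog_uniq f0 (dhomog_msize fe) fe.
  exists 1%N, (fun=> 1), (fun=> f); rewrite big_ord1 mul1r; split=> // _.
  by split=> //; exists e.
by have [_] := leastP (ex_intro S e Se); apply.
Qed.

Theorem corollary3p3 (K : fieldType) (k n a : nat) (X : 'I_n -> proj_point K k)
    (hk : (3 <= k)%N) (hX : injective X) (hspan : ~ in_hyperplane X)
    (ha : (1 <= a)%N) :
  (k%:Z - 1) * ((initial_degree X)%:Z - 1 - a%:Z) + 1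
    <= (minimum_distance (evaluation_code X a))%:Z.
Proof.
(* If there were no points, any nonzero linear form would contradict [hspan]. Positivity of [n]
   provides two distinct codewords, so [least] is a true minimum below. *)
have n0 : (0 < n)%N.
  rewrite lt0n; apply/eqP => n0; apply: hspan.
  have [|l [l1 l0 _]] := @linear_form_through K k [::]; first by rewrite /=; lia.
  by exists l; split=> // i; have := ltn_ord i; rewrite {2}n0.
have [u [w [Cu Cw uw]]] := evaluation_code_nontrivial X a n0.
set S := fun d => exists u w : 'rV[K]_n,
  [/\ evaluation_code X a u, evaluation_code X a w, u <> w & hamming_distance u w = d].
have [|] := @leastP S; first by exists (hamming_distance u w), u, w.
rewrite -/(minimum_distance _); set d := minimum_distance _ => + _.
move=> [{Cu}_ [{Cw uw}_ [[f fa ->] [g ga ->] uw dE]]].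
rewrite /hamming_distance in dE; set Y := [set i | _] in dE.
have Y_gt0 : (0 < #|Y|)%N.
  rewrite card_gt0; apply: contra_not_neq uw => Y0; apply/rowP => i.
  by have := in_set0 i; rewrite -Y0 inE => /negbFE/eqP.
(* Since [Y] is nonempty, this degree is the ceiling of [#|Y| / (k - 1)]. *)
have [h [hm h0 hY]] : exists h : {mpoly K[k]},
    [/\ h \is (#|Y|.-1 %/ k.-1).+1.-homog, h != 0
      & forall i, i \in enum Y -> eval_at h (X i) = 0].
  apply: form_through; first by lia.
  rewrite -cardE; have := @ltn_ceil #|Y|.-1 k.-1; lia.
(* By linearity, the difference of the two forms is a form of degree [a] whose nonvanishing set in
   [X] is [Y]. *)
have fg0 : f - g != 0 by apply: contra_not_neq uw => /subr0_eq->.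
have fgh := dhomogM (rpredB fa ga) hm.
have := initial_degree_le K k n _ X _ fgh (mulf_neq0 fg0 h0).
have fghX i : eval_at ((f - g) * h) (X i) = 0.
  rewrite /eval_at mevalM mevalB; case: (boolP (i \in Y)) => iY.
    by have := hY i; rewrite mem_enum /eval_at => ->; rewrite // mulr0.
  by move: iY; rewrite inE negbK !mxE /eval_at => /eqP->; rewrite subrr mul0r.
(* With [q = (d - 1) %/ (k - 1)], the bound [alpha <= a + q + 1] gives [(k - 1) * (alpha - 1 - a) <=
   (k - 1) * q <= d - 1]. *)
move=> /(_ fghX) le_alpha; have := leq_divM #|Y|.-1 k.-1.
by rewrite -dE; nia.
Qed.
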